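(* Let $R$ be an associative ring with unity $1$ and let $a,b,c,v,w,y\in R$ with at least one of $v$, $w$ invertible. Then the following are equivalent: (i) $yvawy=y$, $yvR=bR$ and $rann(wy)=rann(c)$. (ii) $yvawb=b$, $cvawy=c$, $yvR\subseteq bR$ and $rann(c)\subseteq rann(wy)$.
   Context: For $x\in R$: $xR=\{xr: r\in R\}$ and $rann(x)=\{z\in R: xz=0\}$. *)

(* Defs.v *)
From mathcomp Require Import all_boot all_algebra.
From mathcomp Require Import boolp classical_sets.

Set Implicit Arguments.
Unset Strict Implicit.
Unset Printing Implicit Defensive.

Import GRing.Theory.
Local Open Scope ring_scope.
Local Open Scope classical_set_scope.

(* Rings are [pzRingType]: unital, not necessarily commutative, and the zero
   ring is allowed.  [GRing.unit] is not available at this generality (it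
   needs a [unitRingType]), hence the definition of two-sided invertibility. *)
Definition invertible (R : pzRingType) (x : R) : Prop :=
  exists x' : R, x * x' = 1 /\ x' * x = 1.

Definition right_ideal (R : pzRingType) (x : R) : set R :=
  [set x * r | r in [set: R]].

Definition rann (R : pzRingType) (x : R) : set R :=
  [set z : R | x * z = 0].

(* Main.v *)
(* The equation y v a w y = y is recovered in (ii) => (i) by cancelling: b R
   containing y v gives (y v a w y) v = y v, while rann c being contained in
   rann (w y), applied to v a w y - 1, gives w (y v a w y) = w y; whichever of
   v, w is invertible can be cancelled. *)
Require Import Defs.
From mathcomp Require Import all_boot all_algebra.
From mathcomp Require Import boolp classical_sets.

Import GRing.Theory.

Local Open Scope ring_scope.
Local Open Scope classical_set_scope.

(** Turns an inclusion of annihilators into a transfer of equations; applied with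
    [t = v * a * w * y]. *)
Lemma rann_subr1 {R : pzRingType} (x t : R) : rann x (t - 1) <-> x * t = x.
Proof.
rewrite /rann /= mulrBr mulr1; split; first exact: subr0_eq.
by move=> ->; rewrite subrr.
Qed.

Lemma right_ideal_id {R : pzRingType} (x : R) : right_ideal x x.
Proof. by exists 1 => //; rewrite mulr1. Qed.

Theorem theorem4p1 (R : pzRingType) (a b c v w y : R)
    (hvw : invertible v \/ invertible w) :
  (y * v * a * w * y = y /\
   right_ideal (y * v) = right_ideal b /\
   rann (w * y) = rann c)
  <->
  (y * v * a * w * b = b /\
   c * v * a * w * y = c /\
   right_ideal (y * v) `<=` right_ideal b /\
   rann c `<=` rann (w * y)).
Proof.
split=> [[yE [idE annE]]|[bE [cE [idS annS]]]].
  split; last split; last by rewrite idE annE; split.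
    (* As [b] lies in its own right ideal, [b = y * v * r], which [y * v * a * w] fixes on the left
       by [yE]. *)
    have := right_ideal_id b; rewrite -idE => -[r _ <-].
    by rewrite !mulrA yE.
  have /rann_subr1 : rann c (v * a * w * y - 1).
    by rewrite -annE; apply/rann_subr1; rewrite -[in RHS]yE !mulrA.
  by rewrite !mulrA.
split; last split.
- case: hvw => -[u [ru lu]].
    have [r _ yvE] := idS _ (right_ideal_id (y * v)).
    have yvK : y * v * a * w * y * v = y * v.
      by rewrite -(mulrA _ y v) -{2 3}yvE mulrA bE.
    by rewrite -[LHS]mulr1 -ru mulrA yvK -mulrA ru mulr1.
  have /annS/rann_subr1 wyK : rann c (v * a * w * y - 1).
    by apply/rann_subr1; rewrite !mulrA.
  rewrite -[LHS]mul1r -lu -[RHS]mul1r -lu -!mulrA; congr (u * _).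
  by rewrite -[RHS]wyK !mulrA.
- apply/seteqP; split=> // _ [r _ <-].
  (* The witness is read off [b * r = (y * v * a * w * b) * r]. *)
  by exists (a * w * b * r) => //; rewrite !mulrA bE.
- apply/seteqP; split=> // z; rewrite /rann /= => wyz.
  (* By [cE], [c] is a left multiple of [w * y]. *)
  by rewrite -cE -!mulrA (mulrA w) wyz !mulr0.
Qed.
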